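(* Let $(\;)_0:\mathrm{Grd}\to \mathrm{Set}$ be the forgetful functor from (small) groupoids to sets sending a groupoid to its set of objects. For every set $Y$, the fibre $\mathrm{Grd}_Y$ of this functor over $Y$ is stably $\mathbb P$-decomposable.
   Context: $\mathrm{Grd}_Y$ is the category of groupoids with set of objects $Y$ and of functors which are the identity on objects. Extremal decompositions. Let $\Theta$ be a class of morphisms in a category $\mathbb{D}$ and $v:U\rightarrowtail T$ a monomorphism. A decomposition $v=w.u$ with $u:U\to X$ in $\Theta$ is $\Theta$-extremal when for any other decomposition $v=w'.u'$ with $u':U\to X'$ in $\Theta$, there is a unique $t:X'\to X$ with $w.t=w'$ and $t.u'=u$. $\mathbb{D}$ has stably $\Theta$-extremal decompositions of monomorphisms when any monomorphism has a $\Theta$-extremal decomposition and these are stable under pullback along maps in $\Theta$. For a finitely complete category $\mathbb E$, $\mathrm{Pt}\,\mathbb{E}$ is the category whose objects are the split epimorphisms $(f,s):X\rightleftarrows Z$, $f.s=1_Z$, with chosen splitting, and whose maps $(z,x):(f',s')\to(f,s)$ are pairs with $f.x=z.f'$ and $x.s'=s.z$. $\mathbb P_{\mathbb E}:\mathrm{Pt}\,\mathbb E\to\mathbb E$ sends $(f,s)$ to the codomain of $f$; $(z,x)$ is $\mathbb P_{\mathbb E}$-cartesian iff $f.x=z.f'$ is a pullback square. $\mathbb{E}$ is stably $\mathbb P$-decomposable when $\mathrm{Pt}\,\mathbb E$ has stably $\Theta$-extremal decompositions of monomorphisms for $\Theta$ the class of $\mathbb P_{\mathbb E}$-cartesian maps.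 *)

(* Defs.v *)
(* Plain category theory, with Leibniz equality of arrows. *)
From Stdlib Require Import FunctionalExtensionality ProofIrrelevance.

Set Implicit Arguments.
Unset Strict Implicit.
#[local] Obligation Tactic := intros; simpl; auto.

Record category := Category {
  Ob : Type;
  Hom : Ob -> Ob -> Type;
  idm : forall A, Hom A A;
  comp : forall A B C, Hom B C -> Hom A B -> Hom A C;
  comp_assoc : forall A B C D (h : Hom C D) (g : Hom B C) (f : Hom A B),
    comp h (comp g f) = comp (comp h g) f;
  comp_idl : forall A B (f : Hom A B), comp (idm B) f = f;
  comp_idr : forall A B (f : Hom A B), comp f (idm A) = f
}.

Arguments Hom {c} _ _.
Arguments idm {c} A.
Arguments comp {c A B C} _ _.

Declare Scope cat_scope.
Delimit Scope cat_scope with cat.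
Notation "g ∘ f" := (comp g f) (at level 40, left associativity) : cat_scope.
Local Open Scope cat_scope.

Record functor (D E : category) := Functor {
  fob : Ob D -> Ob E;
  fmap : forall A B : Ob D, Hom A B -> Hom (fob A) (fob B);
  fmap_id : forall A, fmap (idm A) = idm (fob A);
  fmap_comp : forall A B C (g : Hom B C) (f : Hom A B),
    fmap (g ∘ f) = fmap g ∘ fmap f
}.

Arguments fob {D E} _ _.
Arguments fmap {D E} _ {A B} _.

Definition mono (D : category) (U T : Ob D) (v : Hom U T) : Prop :=
  forall (W : Ob D) (a b : Hom W U), v ∘ a = v ∘ b -> a = b.

(*  The square   P --q--> B
                 |        |
                 p        g
                 v        v
                 A --f--> C     is a pullback. *)
Definition is_pullback (D : category) (P A B C : Ob D)
    (p : Hom P A) (q : Hom P B) (f : Hom A C) (g : Hom B C) : Prop :=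
  f ∘ p = g ∘ q /\
  forall (W : Ob D) (a : Hom W A) (b : Hom W B), f ∘ a = g ∘ b ->
    exists! t : Hom W P, p ∘ t = a /\ q ∘ t = b.

Definition is_terminal (D : category) (T : Ob D) : Prop :=
  forall W : Ob D, exists! t : Hom W T, True.

Definition finitely_complete (D : category) : Prop :=
  (exists T : Ob D, is_terminal T) /\
  (forall (A B C : Ob D) (f : Hom A C) (g : Hom B C),
     exists (P : Ob D) (p : Hom P A) (q : Hom P B), is_pullback p q f g).

Definition cartesian (D E : category) (F : functor D E)
    (X X' : Ob D) (phi : Hom X X') : Prop :=
  forall (W : Ob D) (psi : Hom W X') (g : Hom (fob F W) (fob F X)),
    fmap F phi ∘ g = fmap F psi ->
    exists! chi : Hom W X, phi ∘ chi = psi /\ fmap F chi = g.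

Section Extremal.

Variable D : category.
Variable Theta : forall A B : Ob D, Hom A B -> Prop.

Definition extremal_decomposition (U X T : Ob D)
    (v : Hom U T) (u : Hom U X) (w : Hom X T) : Prop :=
  Theta u /\ v = w ∘ u /\
  forall (X' : Ob D) (u' : Hom U X') (w' : Hom X' T),
    Theta u' -> v = w' ∘ u' ->
    exists! t : Hom X' X, w ∘ t = w' /\ t ∘ u' = u.

(* In the stability clause, (U', v') and (X', w') are the pullbacks along
   theta : T' -> T of (U, v) and (X, w), and u' : U' -> X' is the comparison
   map induced by u, i.e. the pullback of u. *)
Definition stably_extremal_decompositions : Prop :=
  (forall (U T : Ob D) (v : Hom U T), mono v ->
     exists (X : Ob D) (u : Hom U X) (w : Hom X T),
       extremal_decomposition v u w) /\
  (forall (U X T : Ob D) (v : Hom U T) (u : Hom U X) (w : Hom X T),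
     mono v -> extremal_decomposition v u w ->
     forall (T' : Ob D) (theta : Hom T' T), Theta theta ->
     forall (U' X' : Ob D) (v' : Hom U' T') (h : Hom U' U)
            (w' : Hom X' T') (k : Hom X' X) (u' : Hom U' X'),
       is_pullback v' h theta v ->
       is_pullback w' k theta w ->
       w' ∘ u' = v' -> k ∘ u' = u ∘ h ->
       extremal_decomposition v' u' w').

End Extremal.

Section Points.

Variable E : category.

Record point := Point {
  pt_tot : Ob E;
  pt_base : Ob E;
  pt_proj : Hom pt_tot pt_base;
  pt_sect : Hom pt_base pt_tot;
  pt_split : pt_proj ∘ pt_sect = idm pt_base
}.

Record point_hom (P Q : point) := PointHom {
  ph_base : Hom (pt_base P) (pt_base Q);
  ph_tot : Hom (pt_tot P) (pt_tot Q);
  ph_proj : pt_proj Q ∘ ph_tot = ph_base ∘ pt_proj P;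
  ph_sect : ph_tot ∘ pt_sect P = pt_sect Q ∘ ph_base
}.

Lemma point_hom_eq (P Q : point) (a b : point_hom P Q) :
  ph_base a = ph_base b -> ph_tot a = ph_tot b -> a = b.
Proof.
destruct a as [z x p s], b as [z' x' p' s']; simpl; intros <- <-.
f_equal; apply proof_irrelevance.
Qed.

Program Definition point_id (P : point) : point_hom P P :=
  {| ph_base := idm (pt_base P); ph_tot := idm (pt_tot P) |}.
Next Obligation. now rewrite comp_idl, comp_idr. Qed.
Next Obligation. now rewrite comp_idl, comp_idr. Qed.

Program Definition point_comp (P Q R : point)
    (b : point_hom Q R) (a : point_hom P Q) : point_hom P R :=
  {| ph_base := ph_base b ∘ ph_base a; ph_tot := ph_tot b ∘ ph_tot a |}.
Next Obligation.
now rewrite comp_assoc, ph_proj, <- comp_assoc, ph_proj, comp_assoc.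
Qed.
Next Obligation.
now rewrite <- comp_assoc, ph_sect, comp_assoc, ph_sect, comp_assoc.
Qed.

Program Definition Pt : category :=
  {| Ob := point; Hom := point_hom; idm := point_id; comp := point_comp |}.
Next Obligation. apply point_hom_eq; apply comp_assoc. Qed.
Next Obligation. apply point_hom_eq; apply comp_idl. Qed.
Next Obligation. apply point_hom_eq; apply comp_idr. Qed.

Program Definition pt_functor : functor Pt E :=
  {| fob := pt_base : Ob Pt -> Ob E;
     fmap := fun (P Q : Ob Pt) (a : Hom P Q) => ph_base a |}.

(* The cartesian maps of the fibration of points are the pullback squares. *)
Lemma cartesian_pt_functorP : finitely_complete E ->
  forall (P Q : Ob Pt) (a : Hom P Q),
    cartesian pt_functor a <->
    is_pullback (ph_tot a) (pt_proj P) (pt_proj Q) (ph_base a).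
Proof.
intros [_ pb] P Q a; split.
- intros cart; split; [apply ph_proj|].
  destruct (pb _ _ _ (pt_proj Q) (ph_base a)) as (R & x & f & sq & univ).
  destruct (univ _ (pt_sect Q ∘ ph_base a) (idm _)) as (s & [xs fs] & _).
  { now rewrite comp_assoc, pt_split, comp_idl, comp_idr. }
  pose (S := Point fs : Ob Pt).
  pose (b := @PointHom S Q (ph_base a) x sq xs : Hom S Q).
  destruct (cart S b (idm _)) as (c & [ac cb] & _).
  { apply comp_idr. }
  simpl in cb.
  assert (ac2 : ph_tot a ∘ ph_tot c = x) by exact (f_equal (@ph_tot S Q) ac).
  assert (pc : pt_proj P ∘ ph_tot c = f).
  { rewrite ph_proj, cb; apply comp_idl. }
  (* the comparison d : P -> S satisfies c ∘ d = id, by cartesianness of a *)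
  destruct (univ _ (ph_tot a) (pt_proj P) (ph_proj a)) as (d & [xd fd] & _).
  assert (ds : d ∘ pt_sect P = s).
  { destruct (univ _ (pt_sect Q ∘ ph_base a) (idm _)) as (s0 & _ & us0).
    { now rewrite comp_assoc, pt_split, comp_idl, comp_idr. }
    transitivity s0; [symmetry|]; apply us0; split; auto.
    - now rewrite comp_assoc, xd, ph_sect.
    - now rewrite comp_assoc, fd, pt_split. }
  assert (dp : pt_proj S ∘ d = idm _ ∘ pt_proj P).
  { rewrite comp_idl; exact fd. }
  assert (dq : d ∘ pt_sect P = pt_sect S ∘ idm _).
  { rewrite comp_idr; exact ds. }
  pose (e := @PointHom P S (idm _) d dp dq : Hom P S).
  assert (ce : c ∘ e = idm P).
  { destruct (cart P a (idm _)) as (i & _ & ui); [apply comp_idr|].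
    transitivity i; [symmetry|]; apply ui; split.
    - rewrite comp_assoc, ac; apply point_hom_eq; simpl;
        [apply comp_idr | exact xd].
    - simpl; rewrite cb; apply comp_idl.
    - apply comp_idr.
    - reflexivity. }
  assert (cd : ph_tot c ∘ d = idm _) by exact (f_equal (@ph_tot P P) ce).
  intros W y z yz; destruct (univ W y z yz) as (t & [xt ft] & ut).
  exists (ph_tot c ∘ t); split; [split|].
  + now rewrite comp_assoc, ac2.
  + now rewrite comp_assoc, pc.
  + intros t' [xt' ft'].
    rewrite (ut (d ∘ t')).
    * etransitivity; [apply comp_assoc|].
      etransitivity; [exact (f_equal (fun m => m ∘ t') cd) | apply comp_idl].
    * now rewrite !comp_assoc, xd, fd.
- intros [sq univ] W b g ag; simpl in *.
  destruct (univ _ (ph_tot b) (g ∘ pt_proj W)) as (t & [at_ pt] & ut).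
  { now rewrite ph_proj, comp_assoc, ag. }
  assert (ts : t ∘ pt_sect W = pt_sect P ∘ g).
  { destruct (univ _ (ph_tot b ∘ pt_sect W) g) as (r & _ & ur).
    { now rewrite comp_assoc, ph_proj, <- comp_assoc, pt_split, comp_idr. }
    transitivity r; [symmetry|]; apply ur; split.
    - now rewrite comp_assoc, at_.
    - now rewrite comp_assoc, pt, <- comp_assoc, pt_split, comp_idr.
    - now rewrite comp_assoc, ph_sect, <- comp_assoc, ag, ph_sect.
    - now rewrite comp_assoc, pt_split, comp_idl. }
  exists (PointHom pt ts); split; [split|].
  + now apply point_hom_eq.
  + reflexivity.
  + intros c [ac cg]; apply point_hom_eq; simpl.
    * now symmetry.
    * apply ut; split; [now rewrite <- ac|].
      now rewrite ph_proj, cg.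
Qed.

Definition stably_P_decomposable : Prop :=
  finitely_complete E /\
  stably_extremal_decompositions
    (fun (P Q : Ob Pt) (a : Hom P Q) => cartesian pt_functor a).

End Points.

Section GroupoidsOver.

Variable Y : Type.

Record groupoid_on := GroupoidOn {
  arr : Y -> Y -> Type;
  gid : forall x, arr x x;
  gcomp : forall x y z, arr y z -> arr x y -> arr x z;
  ginv : forall x y, arr x y -> arr y x;
  gcomp_assoc : forall x y z t (h : arr z t) (g : arr y z) (f : arr x y),
    gcomp h (gcomp g f) = gcomp (gcomp h g) f;
  gcomp_idl : forall x y (f : arr x y), gcomp (gid y) f = f;
  gcomp_idr : forall x y (f : arr x y), gcomp f (gid x) = f;
  gcomp_invl : forall x y (f : arr x y), gcomp (ginv f) f = gid x;
  gcomp_invr : forall x y (f : arr x y), gcomp f (ginv f) = gid y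
}.

(* Functors that are the identity on objects. *)
Record grd_hom (G H : groupoid_on) := GrdHom {
  gmap :> forall x y, arr G x y -> arr H x y;
  gmap_id : forall x, gmap (gid G x) = gid H x;
  gmap_comp : forall x y z (g : arr G y z) (f : arr G x y),
    gmap (gcomp g f) = gcomp (gmap g) (gmap f)
}.

Lemma grd_hom_eq (G H : groupoid_on) (a b : grd_hom G H) :
  (forall x y (f : arr G x y), a x y f = b x y f) -> a = b.
Proof.
destruct a as [a ai ac], b as [b bi bc]; simpl; intros ab.
assert (eab : a = b).
{ extensionality x; extensionality y; extensionality f; apply ab. }
subst b; f_equal; apply proof_irrelevance.
Qed.

Program Definition grd_id (G : groupoid_on) : grd_hom G G :=
  {| gmap := fun x y f => f |}.

Program Definition grd_comp (G H K : groupoid_on)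
    (b : grd_hom H K) (a : grd_hom G H) : grd_hom G K :=
  {| gmap := fun x y f => b x y (a x y f) |}.
Next Obligation. now rewrite !gmap_id. Qed.
Next Obligation. now rewrite !gmap_comp. Qed.

Program Definition Grd : category :=
  {| Ob := groupoid_on; Hom := grd_hom; idm := grd_id; comp := grd_comp |}.
Next Obligation. now apply grd_hom_eq. Qed.
Next Obligation. now apply grd_hom_eq. Qed.
Next Obligation. now apply grd_hom_eq. Qed.

End GroupoidsOver.

(* Main.v *)
Require Import Defs.
From Stdlib Require Import IndefiniteDescription ProofIrrelevance.

(** A point [(f, s) : X ⇄ Z] in [Grd Y] is a family of groups acted on by [Z]:
    with [K_y] the group of the arrows [k : y -> y] of [X] such that [f k] is
    an identity, each arrow of [X] is uniquely [k · s z] with [k] in [K] and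
    [z] in [Z], and [z] acts on [K] by conjugation by [s z].  Under this
    description a map of points is cartesian when it is bijective on the
    kernels [K].

    Let [v : U -> T] be monic.  The images under [v] of the kernels of [U] form
    a family [K] of subgroups of the kernels of [T].  In a decomposition
    [v = w' ∘ u'] with [u'] cartesian, the kernels of the middle point [X'] are
    those of [U], so that [w'] maps them onto [K]; hence [w'] maps the base of
    [X'] into the normalizer [N] of [K], the groupoid of the arrows [z] for
    which conjugation by [s z] carries [K] onto itself, and it maps the total
    part into the semidirect product of [K] and [N].  This semidirect product
    with its projection to [N] is itself a point, and it provides the extremal
    decomposition ([normalizer_strongly_extremal]).

    The same argument applies when [w' ∘ u' = v ∘ h] with [h] cartesian, since
    precomposing [v] with [h] leaves [K] unchanged.  Extremality in this
    stronger form ([strongly_extremal]) is formally stable under pullback along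
    cartesian maps, for any functor which preserves monomorphisms
    ([strongly_extremal_pullback]). *)

Set Implicit Arguments.
Unset Strict Implicit.
Local Open Scope cat_scope.

(** * Extremal decompositions relative to cartesian maps *)

Section Fibration.

Variables (D E : category) (F : functor D E).

Lemma mono_pullback (P A B C : Ob D)
    (p : Hom P A) (q : Hom P B) (f : Hom A C) (g : Hom B C) :
  is_pullback p q f g -> mono g -> mono p.
Proof.
intros [sq univ] mg W a b pab.
assert (qab : q ∘ a = q ∘ b).
{ apply mg; now rewrite !comp_assoc, <- sq, <- !comp_assoc, pab. }
destruct (univ W (p ∘ b) (q ∘ b)) as (t & _ & ut).
{ now rewrite !comp_assoc, sq. }
transitivity t; [symmetry|]; apply ut; auto.
Qed.

Lemma cartesian_id (X : Ob D) : cartesian F (idm X).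
Proof.
intros W psi g; rewrite fmap_id, comp_idl; intros ->.
exists psi; split; [split|].
- apply comp_idl.
- reflexivity.
- intros c [<- _]; apply comp_idl.
Qed.

Lemma cartesian_comp (X Y Z : Ob D) (b : Hom Y Z) (a : Hom X Y) :
  cartesian F b -> cartesian F a -> cartesian F (b ∘ a).
Proof.
intros cb ca W psi g; rewrite fmap_comp, <- comp_assoc; intros bag.
destruct (cb W psi _ bag) as (c & [bc Fc] & uc).
destruct (ca W c g (eq_sym Fc)) as (d & [ad Fd] & ud).
exists d; split; [split|].
- now rewrite <- comp_assoc, ad.
- exact Fd.
- intros d' [bad Fd']; apply ud; split; [|exact Fd'].
  symmetry; apply uc; split; [now rewrite comp_assoc|].
  now rewrite fmap_comp, Fd'.
Qed.

(** A lift of [b ∘ psi] along [b ∘ a] is a lift of [psi] along [a], because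
    lifts along [b] are unique. *)
Lemma cartesian_cancel (X Y Z : Ob D) (b : Hom Y Z) (a : Hom X Y) :
  cartesian F b -> cartesian F (b ∘ a) -> cartesian F a.
Proof.
intros cb cba W psi g ag.
destruct (cba W (b ∘ psi) g) as (c & [bac Fc] & uc).
{ now rewrite !fmap_comp, <- comp_assoc, ag. }
exists c; split; [split|].
- destruct (cb W (b ∘ psi) (fmap F psi)) as (d & _ & ud).
  { now rewrite fmap_comp. }
  transitivity d; [symmetry|]; apply ud; split; auto.
  + now rewrite comp_assoc.
  + now rewrite fmap_comp, Fc.
- exact Fc.
- intros c' [ac' Fc']; apply uc; split; [|exact Fc'].
  now rewrite <- comp_assoc, ac'.
Qed.

Hypothesis fmap_mono : forall (U T : Ob D) (v : Hom U T),
  mono v -> mono (fmap F v).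

(** A lift along [f] of a map into [C] factors through the pullback [P]; that
    it lies over the prescribed map of bases is tested after the monomorphism
    [fmap F p]. *)
Lemma cartesian_pullback (P A B C : Ob D)
    (p : Hom P A) (q : Hom P B) (f : Hom A C) (g : Hom B C) :
  is_pullback p q f g -> mono g -> cartesian F f -> cartesian F q.
Proof.
intros pb mg cf W psi k qk.
pose proof (mono_pullback pb mg) as mp.
destruct pb as [sq univ].
destruct (cf W (g ∘ psi) (fmap F p ∘ k)) as (c & [fc Fc] & uc).
{ now rewrite comp_assoc, <- fmap_comp, sq, !fmap_comp, <- comp_assoc, qk. }
destruct (univ W c psi fc) as (t & [pt qt] & _).
exists t; split; [split|].
- exact qt.
- apply (fmap_mono mp); now rewrite <- fmap_comp, pt.
- intros t' [qt' Ft']; apply mp; rewrite pt; apply uc; split.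
  + now rewrite comp_assoc, sq, <- comp_assoc, qt'.
  + now rewrite fmap_comp, Ft'.
Qed.

(** The form of extremality that survives pullback: competitors [(u', w')] are
    allowed to decompose [v ∘ h] for an arbitrary cartesian [h], instead of
    [v] alone.  As [w] is monic, the factorization is unique and compatible
    with [u'] as soon as it exists. *)
Definition strongly_extremal (U X T : Ob D)
    (v : Hom U T) (u : Hom U X) (w : Hom X T) : Prop :=
  cartesian F u /\ v = w ∘ u /\ mono w /\
  forall (U' X' : Ob D) (h : Hom U' U) (u' : Hom U' X') (w' : Hom X' T),
    cartesian F h -> cartesian F u' -> w' ∘ u' = v ∘ h ->
    exists t : Hom X' X, w ∘ t = w'.

Lemma strongly_extremal_extremal (U X T : Ob D)
    (v : Hom U T) (u : Hom U X) (w : Hom X T) :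
  strongly_extremal v u w ->
  extremal_decomposition
    (fun (A B : Ob D) (a : Hom A B) => cartesian F a) v u w.
Proof.
intros (cu & e & mw & ext); split; [exact cu|split; [exact e|]].
intros X' u' w' cu' e'.
destruct (ext U X' (idm U) u' w') as (t & wt).
{ apply cartesian_id. }
{ exact cu'. }
{ now rewrite comp_idr. }
exists t; split; [split|].
- exact wt.
- apply mw; now rewrite comp_assoc, wt, <- e, <- e'.
- intros t' [wt' _]; apply mw; now rewrite wt, wt'.
Qed.

(** Two extremal decompositions of [v] are isomorphic, so that one strongly
    extremal decomposition makes them all strongly extremal. *)
Lemma extremal_strongly_extremal (U X X0 T : Ob D) (v : Hom U T)
    (u : Hom U X) (w : Hom X T) (u0 : Hom U X0) (w0 : Hom X0 T) :
  strongly_extremal v u0 w0 ->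
  extremal_decomposition
    (fun (A B : Ob D) (a : Hom A B) => cartesian F a) v u w ->
  strongly_extremal v u w.
Proof.
intros str (cu & e & ext).
destruct (strongly_extremal_extremal str) as (cu0 & e0 & ext0).
destruct str as (_ & _ & mw0 & str).
destruct (ext X0 u0 w0 cu0 e0) as (t & [wt tu] & _).
destruct (ext0 X u w cu e) as (s & [ws su] & _).
assert (ts : t ∘ s = idm X).
{ destruct (ext X u w cu e) as (i & _ & ui).
  transitivity i; [symmetry|]; apply ui; split.
  - now rewrite comp_assoc, wt.
  - now rewrite <- comp_assoc, su.
  - apply comp_idr.
  - apply comp_idl. }
split; [exact cu|split; [exact e|split]].
- intros W a b wab.
  rewrite <- (comp_idl a), <- (comp_idl b), <- ts, <- !comp_assoc.
  f_equal; apply mw0; now rewrite !comp_assoc, ws.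
- intros U' X' h u' w' ch cu' e'.
  destruct (str U' X' h u' w' ch cu' e') as (r & wr).
  exists (t ∘ r); now rewrite comp_assoc, wt.
Qed.

(** A competitor over [T'] becomes, after composition with [theta], a
    competitor over [T] for a longer cartesian map into [U]; the resulting
    factorization lifts to the pullback [X']. *)
Lemma strongly_extremal_pullback (U X T T' U' X' : Ob D)
    (v : Hom U T) (u : Hom U X) (w : Hom X T) (theta : Hom T' T)
    (v' : Hom U' T') (h : Hom U' U) (w' : Hom X' T') (k : Hom X' X)
    (u' : Hom U' X') :
  mono v -> strongly_extremal v u w -> cartesian F theta ->
  is_pullback v' h theta v -> is_pullback w' k theta w ->
  w' ∘ u' = v' -> k ∘ u' = u ∘ h ->
  strongly_extremal v' u' w'.
Proof.
intros mv (cu & e & mw & str) ct pbU pbX e' ku.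
pose proof (cartesian_pullback pbU mv ct) as ch.
pose proof (cartesian_pullback pbX mw ct) as ck.
split; [|split; [now symmetry|split]].
- apply (cartesian_cancel ck); rewrite ku; now apply cartesian_comp.
- exact (mono_pullback pbX mw).
- intros U2 X2 h2 u2 w2 ch2 cu2 e2.
  destruct (str U2 X2 (h ∘ h2) u2 (theta ∘ w2)) as (t & wt).
  { now apply cartesian_comp. }
  { exact cu2. }
  { destruct pbU as [sq _].
    now rewrite <- comp_assoc, e2, !comp_assoc, sq. }
  destruct pbX as [_ univ].
  destruct (univ X2 w2 t (eq_sym wt)) as (r & [wr _] & _).
  now exists r.
Qed.

Lemma stably_extremal_of_strongly_extremal :
  (forall (U T : Ob D) (v : Hom U T), mono v ->
     exists (X : Ob D) (u : Hom U X) (w : Hom X T),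
       strongly_extremal v u w) ->
  stably_extremal_decompositions
    (fun (A B : Ob D) (a : Hom A B) => cartesian F a).
Proof.
intros dec; split.
- intros U T v mv; destruct (dec U T v mv) as (X & u & w & str).
  exists X, u, w; now apply strongly_extremal_extremal.
- intros U X T v u w mv ext T' theta ct U' X' v' h w' k u' pbU pbX e ku.
  destruct (dec U T v mv) as (X0 & u0 & w0 & str).
  apply strongly_extremal_extremal.
  exact (strongly_extremal_pullback mv (extremal_strongly_extremal str ext)
    ct pbU pbX e ku).
Qed.

End Fibration.

(** * Monomorphisms of points *)

Section PointMonos.

Variable E : category.

(** The base functor has the left adjoint sending [W] to the identity point on
    [W], hence it preserves monomorphisms. *)
Lemma mono_ph_base (P Q : Ob (Pt E)) (v : Hom P Q) :
  mono v -> mono (ph_base v).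
Proof.
intros mv W a b ab.
pose (I := @Point E W W (idm W) (idm W) (comp_idl _)).
assert (proj : forall c : Hom W (pt_base P),
  pt_proj P ∘ (pt_sect P ∘ c) = c ∘ pt_proj I).
{ intros c; simpl; now rewrite comp_assoc, pt_split, comp_idl, comp_idr. }
assert (sect : forall c : Hom W (pt_base P),
  (pt_sect P ∘ c) ∘ pt_sect I = pt_sect P ∘ c).
{ intros c; apply comp_idr. }
pose (ext := fun c => @PointHom E I P c _ (proj c) (sect c)).
apply (f_equal (@ph_base E I P) (x := ext a) (y := ext b)).
apply mv, point_hom_eq; simpl; [exact ab|].
now rewrite !comp_assoc, ph_sect, <- !comp_assoc, ab.
Qed.

(** As the base of [v] is monic, the kernel pair of its total part is itself
    the total object of a point over [pt_base P], and [v] coequalizes its two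
    projections. *)
Lemma mono_ph_tot (P Q : Ob (Pt E)) (v : Hom P Q) :
  finitely_complete E -> mono v -> mono (ph_tot v).
Proof.
intros [_ pb] mv.
destruct (pb _ _ _ (ph_tot v) (ph_tot v)) as (R & p & q & sq & univ).
assert (fpq : pt_proj P ∘ p = pt_proj P ∘ q).
{ apply (mono_ph_base mv).
  now rewrite !comp_assoc, <- !ph_proj, <- !comp_assoc, sq. }
destruct (univ _ (pt_sect P) (pt_sect P) eq_refl) as (r & [pr qr] & _).
assert (split : (pt_proj P ∘ p) ∘ r = idm _).
{ now rewrite <- comp_assoc, pr, pt_split. }
pose (S := Point split).
assert (pproj : pt_proj P ∘ p = idm _ ∘ pt_proj S) by now rewrite comp_idl.
assert (qproj : pt_proj P ∘ q = idm _ ∘ pt_proj S) by now rewrite comp_idl.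
assert (psect : p ∘ pt_sect S = pt_sect P ∘ idm _) by now rewrite comp_idr.
assert (qsect : q ∘ pt_sect S = pt_sect P ∘ idm _) by now rewrite comp_idr.
assert (pq : p = q).
{ apply (f_equal (@ph_tot E S P)
    (x := @PointHom E S P _ p pproj psect)
    (y := @PointHom E S P _ q qproj qsect)).
  now apply mv, point_hom_eq. }
intros W a b ab.
destruct (univ W a b ab) as (t & [pt qt] & _).
now rewrite <- pt, <- qt, pq.
Qed.

End PointMonos.

(** * Limits and monomorphisms of groupoids on a fixed set *)

Section Groupoids.

Variable Y : Type.
Implicit Types G H : groupoid_on Y.

Lemma ginv_unique G x y (f : arr G x y) (g : arr G y x) :
  gcomp g f = gid G x -> g = ginv f.
Proof.
intros gf.
now rewrite <- (gcomp_idr g), <- (gcomp_invr f), gcomp_assoc, gf, gcomp_idl.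
Qed.

Lemma ginv_id G x : ginv (gid G x) = gid G x.
Proof. symmetry; apply ginv_unique, gcomp_idl. Qed.

Lemma ginv_inv G x y (f : arr G x y) : ginv (ginv f) = f.
Proof. symmetry; apply ginv_unique, gcomp_invr. Qed.

Lemma ginv_comp G x y z (g : arr G y z) (f : arr G x y) :
  ginv (gcomp g f) = gcomp (ginv f) (ginv g).
Proof.
symmetry; apply ginv_unique.
now rewrite <- gcomp_assoc, (gcomp_assoc (ginv g)), gcomp_invl, gcomp_idl,
  gcomp_invl.
Qed.

Lemma gmap_inv G H (a : grd_hom G H) x y (f : arr G x y) :
  gmap a (ginv f) = ginv (gmap a f).
Proof. apply ginv_unique; now rewrite <- gmap_comp, gcomp_invl, gmap_id. Qed.

Lemma gmap_eq G H (a b : grd_hom G H) : a = b ->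
  forall x y (f : arr G x y), gmap a f = gmap b f.
Proof. now intros ->. Qed.

Section Subgroupoid.

Variables (G : groupoid_on Y) (S : forall x y, arr G x y -> Prop).
Arguments S {x y} _.
Hypothesis S_id : forall x, S (gid G x).
Hypothesis S_comp : forall x y z (g : arr G y z) (f : arr G x y),
  S g -> S f -> S (gcomp g f).
Hypothesis S_inv : forall x y (f : arr G x y), S f -> S (ginv f).

Lemma sub_eq x y (f g : {f : arr G x y | S f}) :
  proj1_sig f = proj1_sig g -> f = g.
Proof.
destruct f as [f Sf], g as [g Sg]; simpl; intros <-.
f_equal; apply proof_irrelevance.
Qed.

Program Definition subgroupoid : groupoid_on Y :=
  {| arr := fun x y => {f : arr G x y | S f};
     gid := fun x => exist _ (gid G x) (S_id x);
     gcomp := fun x y z g f => exist _ (gcomp (proj1_sig g) (proj1_sig f))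
       (S_comp (proj2_sig g) (proj2_sig f));
     ginv := fun x y f => exist _ (ginv (proj1_sig f))
       (S_inv (proj2_sig f)) |}.
Next Obligation. apply sub_eq, gcomp_assoc. Qed.
Next Obligation. apply sub_eq, gcomp_idl. Qed.
Next Obligation. apply sub_eq, gcomp_idr. Qed.
Next Obligation. apply sub_eq, gcomp_invl. Qed.
Next Obligation. apply sub_eq, gcomp_invr. Qed.

Definition sub_incl : grd_hom subgroupoid G.
Proof. now exists (fun x y (f : arr subgroupoid x y) => proj1_sig f). Defined.

Definition sub_corestrict W (a : grd_hom W G)
  (Sa : forall x y (f : arr W x y), S (gmap a f)) : grd_hom W subgroupoid.
Proof.
exists (fun x y (f : arr W x y) =>
  exist _ (gmap a f) (Sa x y f) : arr subgroupoid x y).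
- intros x; apply sub_eq, gmap_id.
- intros x y z g f; apply sub_eq, gmap_comp.
Defined.

Lemma mono_sub_incl : mono (sub_incl : Hom (c := Grd Y) subgroupoid G).
Proof.
intros W a b ab; apply grd_hom_eq; intros x y f.
exact (sub_eq (gmap_eq ab f)).
Qed.

End Subgroupoid.

#[local] Obligation Tactic := intros; apply injective_projections; simpl.

Program Definition prod_grd G H : groupoid_on Y :=
  {| arr := fun x y => (arr G x y * arr H x y)%type;
     gid := fun x => (gid G x, gid H x);
     gcomp := fun x y z g f => (gcomp (fst g) (fst f), gcomp (snd g) (snd f));
     ginv := fun x y f => (ginv (fst f), ginv (snd f)) |}.
Next Obligation. all: apply gcomp_assoc. Qed.
Next Obligation. all: apply gcomp_idl. Qed.
Next Obligation. all: apply gcomp_idr. Qed.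
Next Obligation. all: apply gcomp_invl. Qed.
Next Obligation. all: apply gcomp_invr. Qed.

Section Pullback.

Variables (A B C : groupoid_on Y) (f : grd_hom A C) (g : grd_hom B C).

Definition pullback_grd : groupoid_on Y.
Proof.
refine (@subgroupoid (prod_grd A B)
  (fun x y e => gmap f (fst e) = gmap g (snd e)) _ _ _); simpl.
- intros x; now rewrite !gmap_id.
- intros x y z e d; rewrite !gmap_comp; congruence.
- intros x y e; rewrite !gmap_inv; congruence.
Defined.

Definition pullback_fst : grd_hom pullback_grd A.
Proof.
now exists (fun x y (e : arr pullback_grd x y) => fst (proj1_sig e)).
Defined.

Definition pullback_snd : grd_hom pullback_grd B.
Proof.
now exists (fun x y (e : arr pullback_grd x y) => snd (proj1_sig e)).
Defined.

Lemma pullback_grdP :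
  is_pullback (pullback_fst : Hom (c := Grd Y) pullback_grd A)
    pullback_snd f g.
Proof.
split.
- apply grd_hom_eq; intros x y e; exact (proj2_sig e).
- intros W a b ab; simpl in *.
  unshelve eexists.
  { exists (fun x y (e : arr W x y) =>
      exist _ (gmap a e, gmap b e) (gmap_eq ab e) : arr pullback_grd x y).
    - intros x; apply sub_eq; simpl; now rewrite !gmap_id.
    - intros x y z d e; apply sub_eq; simpl; now rewrite !gmap_comp. }
  split; [split|].
  + now apply grd_hom_eq.
  + now apply grd_hom_eq.
  + intros t [<- <-]; apply grd_hom_eq; intros x y e.
    apply sub_eq; exact (eq_sym (surjective_pairing (proj1_sig (gmap t e)))).
Qed.

End Pullback.

Lemma terminal_Grd : exists T : Ob (Grd Y), is_terminal T.
Proof.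
unshelve eexists.
- refine (@GroupoidOn Y (fun _ _ => unit) (fun _ => tt)
    (fun _ _ _ _ _ => tt) (fun _ _ _ => tt) _ _ _ _ _);
    try now intros ? ? []. all: now intros.
- intros W.
  unshelve eexists.
  + now exists (fun _ _ _ => tt).
  + split; [exact I|]; intros t _; apply grd_hom_eq; intros x y f.
    now destruct (gmap t f).
Qed.

Lemma finitely_complete_Grd : finitely_complete (Grd Y).
Proof.
split; [exact terminal_Grd|].
intros A B C f g.
exists (pullback_grd f g), (pullback_fst f g), (pullback_snd f g).
apply pullback_grdP.
Qed.

(** An abstract pullback receives a map from the concrete pullback of
    pairs, whose value at [(a, b)] is the required arrow. *)
Lemma pullback_surjective (P A B C : Ob (Grd Y))
    (p : Hom P A) (q : Hom P B) (f : Hom A C) (g : Hom B C) :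
  is_pullback p q f g ->
  forall x y (a : arr A x y) (b : arr B x y), gmap f a = gmap g b ->
    exists c : arr P x y, gmap p c = a /\ gmap q c = b.
Proof.
intros [_ univ] x y a b ab.
destruct (pullback_grdP f g) as [sq _].
destruct (univ _ _ _ sq) as (t & [pt qt] & _).
pose (e := exist _ (a, b) ab : arr (pullback_grd f g) x y).
exists (gmap t e); split.
- exact (gmap_eq pt e).
- exact (gmap_eq qt e).
Qed.

(** The two projections of the concrete kernel pair of [v] coincide. *)
Lemma mono_injective (U T : Ob (Grd Y)) (v : Hom U T) : mono v ->
  forall x y (a b : arr U x y), gmap v a = gmap v b -> a = b.
Proof.
intros mv x y a b ab.
destruct (pullback_grdP v v) as [sq _].
exact (gmap_eq (mv _ _ _ sq)
  (exist _ (a, b) ab : arr (pullback_grd v v) x y)).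
Qed.

(** Preimages under an injective functor are unique, hence functorial; they
    are selected by an axiom of choice. *)
Lemma mono_lift (U T W : Ob (Grd Y)) (v : Hom U T) (a : Hom W T) : mono v ->
  (forall x y (f : arr W x y), exists g : arr U x y, gmap v g = gmap a f) ->
  exists b : Hom W U, v ∘ b = a.
Proof.
intros mv im.
pose (pre := fun x y (f : arr W x y) =>
  proj1_sig (constructive_indefinite_description _ (im x y f))).
assert (preE : forall x y (f : arr W x y), gmap v (pre x y f) = gmap a f).
{ intros x y f; exact (proj2_sig
    (constructive_indefinite_description _ (im x y f))). }
unshelve eexists.
- exists pre.
  + intros x; apply (mono_injective mv); now rewrite preE, !gmap_id.
  + intros x y z g f; apply (mono_injective mv).
    now rewrite preE, !gmap_comp, !preE.
- apply grd_hom_eq; exact preE.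
Qed.

End Groupoids.

(** * The normalizer of a subobject in the category of points *)

Section Normalizer.

Variable Y : Type.
Implicit Types P Q U T W : Ob (Pt (Grd Y)).

Definition kernel_image P Q (a : Hom P Q) y
    (k : arr (pt_tot Q) y y) : Prop :=
  exists m : arr (pt_tot P) y y,
    gmap (pt_proj P) m = gid _ y /\ gmap (ph_tot a) m = k.

Lemma ph_projE P Q (a : Hom P Q) x y (f : arr (pt_tot P) x y) :
  gmap (pt_proj Q) (gmap (ph_tot a) f) =
  gmap (ph_base a) (gmap (pt_proj P) f).
Proof. exact (gmap_eq (ph_proj a) f). Qed.

Lemma ph_sectE P Q (a : Hom P Q) x y (z : arr (pt_base P) x y) :
  gmap (ph_tot a) (gmap (pt_sect P) z) =
  gmap (pt_sect Q) (gmap (ph_base a) z).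
Proof. exact (gmap_eq (ph_sect a) z). Qed.

Lemma pt_splitE P x y (z : arr (pt_base P) x y) :
  gmap (pt_proj P) (gmap (pt_sect P) z) = z.
Proof. exact (gmap_eq (pt_split P) z). Qed.

(** A cartesian map restricts to bijections between kernels. *)
Lemma kernel_image_cartesian U W T (h : Hom W U) (v : Hom U T) :
  cartesian (pt_functor (Grd Y)) h ->
  forall y (k : arr (pt_tot T) y y),
    kernel_image (v ∘ h) k <-> kernel_image v k.
Proof.
intros ch y k; split.
- intros (m & pm & <-); exists (gmap (ph_tot h) m); split; [|reflexivity].
  now rewrite ph_projE, pm, gmap_id.
- intros (m & pm & <-).
  apply cartesian_pt_functorP in ch; [|apply finitely_complete_Grd].
  destruct (pullback_surjective ch (a := m) (b := gid _ y)) as (n & hn & pn).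
  { now rewrite pm, gmap_id. }
  exists n; split; [exact pn|]; simpl; now rewrite hn.
Qed.

Section NormalizerPoint.

Variables (U T : Ob (Pt (Grd Y))) (v : Hom U T).

Local Notation K := (kernel_image v).
Local Notation s := (gmap (pt_sect T)).
Local Notation p := (gmap (pt_proj T)).

Lemma kernel_image_id y : K (gid (pt_tot T) y).
Proof. exists (gid _ y); now rewrite !gmap_id. Qed.

Lemma kernel_image_comp y (k l : arr (pt_tot T) y y) :
  K k -> K l -> K (gcomp k l).
Proof.
intros (m & pm & <-) (n & pn & <-); exists (gcomp m n).
now rewrite !gmap_comp, pm, pn, gcomp_idl.
Qed.

Lemma kernel_image_inv y (k : arr (pt_tot T) y y) : K k -> K (ginv k).
Proof.
intros (m & pm & <-); exists (ginv m).
now rewrite !gmap_inv, pm, ginv_id.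
Qed.

(** Conjugation by [s z] maps the subgroup [K] at [x] into the one at [y]; the
    equation [l · s z = s z · k] is used in place of [l = s z · k · (s z)^-1]
    to avoid computing with inverses. *)
Definition carries x y (z : arr (pt_base T) x y) : Prop :=
  forall k, K (y := x) k ->
    exists l, K (y := y) l /\ gcomp l (s z) = gcomp (s z) k.

(** Mapping [K] into [K] is not enough in infinite groups: the inverse
    conjugation must do so as well for these arrows to form a groupoid. *)
Definition normalizes x y (z : arr (pt_base T) x y) : Prop :=
  carries z /\ carries (ginv z).

Lemma carries_id x : carries (gid (pt_base T) x).
Proof.
intros k Kk; exists k; split; [exact Kk|].
now rewrite gmap_id, gcomp_idl, gcomp_idr.
Qed.

Lemma carries_comp x y z (g : arr (pt_base T) y z) (f : arr _ x y) :
  carries g -> carries f -> carries (gcomp g f).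
Proof.
intros cg cf k Kk.
destruct (cf k Kk) as (l & Kl & lf).
destruct (cg l Kl) as (m & Km & mg).
exists m; split; [exact Km|].
now rewrite gmap_comp, gcomp_assoc, mg, <- !gcomp_assoc, lf.
Qed.

Lemma normalizes_id x : normalizes (gid (pt_base T) x).
Proof. split; [|rewrite ginv_id]; apply carries_id. Qed.

Lemma normalizes_comp x y z (g : arr (pt_base T) y z) (f : arr _ x y) :
  normalizes g -> normalizes f -> normalizes (gcomp g f).
Proof.
intros [cg cg'] [cf cf']; split; [|rewrite ginv_comp];
  now apply carries_comp.
Qed.

Lemma normalizes_inv x y (f : arr (pt_base T) x y) :
  normalizes f -> normalizes (ginv f).
Proof. intros [cf cf']; split; [|rewrite ginv_inv]; assumption. Qed.

Definition normalizer : groupoid_on Y :=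
  subgroupoid normalizes_id normalizes_comp normalizes_inv.

(** The arrows of the semidirect product of [K] and its normalizer. *)
Definition semidirect x y (f : arr (pt_tot T) x y) : Prop :=
  normalizes (p f) /\ exists k, K (y := y) k /\ f = gcomp k (s (p f)).

Lemma semidirect_id x : semidirect (gid (pt_tot T) x).
Proof.
split; [rewrite gmap_id; apply normalizes_id|].
exists (gid _ x); split; [apply kernel_image_id|].
now rewrite !gmap_id, gcomp_idl.
Qed.

Lemma semidirect_comp x y z (g : arr (pt_tot T) y z) (f : arr _ x y) :
  semidirect g -> semidirect f -> semidirect (gcomp g f).
Proof.
intros (ng & k & Kk & eg) (nf & l & Kl & ef); split.
{ rewrite gmap_comp; now apply normalizes_comp. }
destruct (proj1 ng l Kl) as (m & Km & mg).
exists (gcomp k m); split; [now apply kernel_image_comp|].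
(* [m] is [l] moved across [s (p g)]:
   [k · m · s (p g) · s (p f) = k · s (p g) · l · s (p f) = g · f] *)
rewrite !gmap_comp, <- gcomp_assoc, (gcomp_assoc m), mg.
rewrite <- (gcomp_assoc _ l), <- ef, gcomp_assoc.
now rewrite <- eg.
Qed.

Lemma semidirect_inv x y (f : arr (pt_tot T) x y) :
  semidirect f -> semidirect (ginv f).
Proof.
intros (nf & k & Kk & ef); split.
{ rewrite gmap_inv; now apply normalizes_inv. }
destruct (proj2 nf (ginv k) (kernel_image_inv Kk)) as (l & Kl & e).
exists l; split; [exact Kl|].
rewrite gmap_inv, e, gmap_inv, <- ginv_comp; now f_equal.
Qed.

Definition semidirect_grd : groupoid_on Y :=
  subgroupoid semidirect_id semidirect_comp semidirect_inv.

Lemma semidirect_sect x y (z : arr (pt_base T) x y) :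
  normalizes z -> semidirect (s z).
Proof.
intros nz; split; rewrite pt_splitE; [exact nz|].
exists (gid _ y); split; [apply kernel_image_id|now rewrite gcomp_idl].
Qed.

Definition normalizer_point : Ob (Pt (Grd Y)).
Proof.
unshelve refine (@Point (Grd Y) semidirect_grd normalizer _ _ _).
- refine (@sub_corestrict Y _ _ _ _ _ _
    (pt_proj T ∘ (sub_incl _ _ _ : Hom (c := Grd Y) semidirect_grd _)) _).
  intros x y f; exact (proj1 (proj2_sig f)).
- refine (@sub_corestrict Y _ _ _ _ _ _
    (pt_sect T ∘ (sub_incl _ _ _ : Hom (c := Grd Y) normalizer _)) _).
  intros x y z; exact (semidirect_sect (proj2_sig z)).
- apply grd_hom_eq; intros x y z; apply sub_eq, pt_splitE.
Defined.

Definition normalizer_incl : Hom normalizer_point T.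
Proof.
unshelve refine (@PointHom (Grd Y) normalizer_point T
  (sub_incl _ _ _) (sub_incl _ _ _) _ _); now apply grd_hom_eq.
Defined.

Lemma mono_normalizer_incl : mono normalizer_incl.
Proof.
intros W a b ab; apply point_hom_eq.
- exact (mono_sub_incl (f_equal (@ph_base _ W T) ab)).
- exact (mono_sub_incl (f_equal (@ph_tot _ W T) ab)).
Qed.

(** Each arrow [f] of [W] is a kernel element times the section of its
    projection [z], and conjugation by the section of [z] preserves the kernel
    of [W]; both facts are carried to [T] by [c]. *)
Lemma normalizer_factor W (c : Hom W T) :
  (forall y (k : arr (pt_tot T) y y), kernel_image c k <-> K k) ->
  exists t : Hom W normalizer_point, normalizer_incl ∘ t = c.
Proof.
intros cK.
assert (cc : forall x y (z : arr (pt_base W) x y),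
  carries (gmap (ph_base c) z)).
{ intros x y z k Kk; apply cK in Kk; destruct Kk as (m & pm & <-).
  (* the conjugate of [m] in [W], whose image is the conjugate of [k] *)
  pose (sz := gmap (pt_sect W) z).
  pose (n := gcomp (gcomp sz m) (ginv sz)).
  exists (gmap (ph_tot c) n); split.
  - apply cK; exists n; split; [|reflexivity].
    unfold n, sz; rewrite !gmap_comp, gmap_inv, pm, pt_splitE.
    now rewrite gcomp_idr, gcomp_invr.
  - rewrite <- ph_sectE, <- !gmap_comp; fold sz; f_equal.
    unfold n; now rewrite <- !gcomp_assoc, gcomp_invl, gcomp_idr. }
assert (nc : forall x y (z : arr (pt_base W) x y),
  normalizes (gmap (ph_base c) z)).
{ intros x y z; split; [|rewrite <- gmap_inv]; apply cc. }
assert (sc : forall x y (f : arr (pt_tot W) x y),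
  semidirect (gmap (ph_tot c) f)).
{ intros x y f; split; rewrite ph_projE; [apply nc|].
  pose (sz := gmap (pt_sect W) (gmap (pt_proj W) f)).
  exists (gmap (ph_tot c) (gcomp f (ginv sz))); split.
  - apply cK; eexists; split; [|reflexivity].
    now unfold sz; rewrite gmap_comp, gmap_inv, pt_splitE, gcomp_invr.
  - rewrite <- ph_sectE, <- gmap_comp; fold sz.
    now rewrite <- gcomp_assoc, gcomp_invl, gcomp_idr. }
unshelve eexists.
- unshelve refine (@PointHom (Grd Y) W normalizer_point
    (sub_corestrict _ _ _ nc) (sub_corestrict _ _ _ sc) _ _).
  + apply grd_hom_eq; intros x y f; apply sub_eq, ph_projE.
  + apply grd_hom_eq; intros x y z; apply sub_eq, ph_sectE.
- now apply point_hom_eq; apply grd_hom_eq.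
Qed.

(** An arrow of the semidirect product lying over the arrow [v z] of the base
    has the form [v k · s (v z) = v (k · s z)]. *)
Lemma cartesian_into_normalizer (u : Hom U normalizer_point) :
  mono v -> normalizer_incl ∘ u = v ->
  cartesian (pt_functor (Grd Y)) u.
Proof.
intros mv wu.
assert (mu : mono u).
{ intros W a b ab; apply mv; now rewrite <- wu, <- !comp_assoc, ab. }
pose proof (mono_ph_base mu) as mub.
pose proof (mono_ph_tot (finitely_complete_Grd Y) mu) as mut.
apply cartesian_pt_functorP; [apply finitely_complete_Grd|].
split; [apply ph_proj|].
intros W a b ab.
destruct (@mono_lift Y _ _ W (ph_tot u) a mut) as (t & ut).
{ intros x y f.
  destruct (proj2_sig (gmap a f)) as (_ & k & (m & pm & <-) & e).
  exists (gcomp m (gmap (pt_sect U) (gmap b f))).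
  apply sub_eq; simpl in *; rewrite e.
  pose proof (f_equal (@proj1_sig _ _) (gmap_eq ab f)) as abf; simpl in abf.
  rewrite abf.
  pose proof (gmap_eq (f_equal (@ph_base _ U T) wu) (gmap b f)) as eb.
  simpl in eb; rewrite eb.
  etransitivity; [exact (gmap_eq (f_equal (@ph_tot _ U T) wu) _)|].
  rewrite gmap_comp; f_equal; apply ph_sectE. }
exists t; split; [split|].
- exact ut.
- apply mub; now rewrite comp_assoc, <- ph_proj, <- comp_assoc, ut.
- intros t' [ut' _]; apply mut; now rewrite ut, ut'.
Qed.

(** The kernel images of [w'], [w' ∘ u' = v ∘ h] and [v] all coincide, as [u']
    and [h] are cartesian. *)
Lemma normalizer_strongly_extremal : mono v ->
  exists u : Hom U normalizer_point,
    strongly_extremal (pt_functor (Grd Y)) v u normalizer_incl.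
Proof.
intros mv.
destruct (@normalizer_factor U v) as (u & wu); [reflexivity|].
exists u; split; [now apply cartesian_into_normalizer|].
split; [now symmetry|split; [apply mono_normalizer_incl|]].
intros U' X' h u' w' ch cu' e.
apply normalizer_factor; intros y k.
rewrite <- (kernel_image_cartesian w' cu' k), e.
apply (kernel_image_cartesian v ch).
Qed.

End NormalizerPoint.

End Normalizer.

Theorem corollary6p2 : forall Y : Type, stably_P_decomposable (Grd Y).
Proof.
intros Y; split; [apply finitely_complete_Grd|].
apply stably_extremal_of_strongly_extremal.
- exact (@mono_ph_base (Grd Y)).
- intros U T v mv.
  destruct (normalizer_strongly_extremal mv) as (u & str).
  now exists (normalizer_point v), u, (normalizer_incl v).
Qed.
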